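(* For every date $D$, every integer $n$ and every date unit $\delta\in\{y,m,d\}$, there exists a value $v_\delta$ such that $D +_\delta n \to^* v_\delta$.
   Context: Values (dates). A value is either the error element $\bot$ or a triple $(y,m,d)$ of integers (year, month, day; January is month $1$); triples need not denote an existing day. ''Date'' means such a value. For an integer $y$ and $1\le m\le 12$, $\mathrm{nb\_days}(y,m)$ is the number of days of month $m$ of year $y$ in the Gregorian calendar: 31 for $m\in\{1,3,5,7,8,10,12\}$, 30 for $m\in\{4,6,9,11\}$, and for $m=2$: 29 if $y$ is leap, else 28, where $y$ is leap iff ($4\mid y$ and $100\nmid y$) or $400\mid y$. Expressions: $e ::= v \mid e +_\delta n$ with $v$ a value, $n\in\mathbb Z$, $\delta\in\{y,m,d\}$ ($+_y,+_m,+_d$: addition of years, months, days). The small-step relation $\to$ is the least relation with the following rules, and $\to^*$ is its reflexive-transitive closure. Error rules: $\bot+_\delta n\to\bot$; if $m\notin[1,12]$ then $(y,m,d)+_\delta n\to\bot$. All following rules assume $1\le m\le 12$. Congruence: if $e\to e'$ then $e+_\delta n\to e'+_\delta n$. Years: $(y,m,d)+_y n\to(y+n,m,d)$. Months: if $1\le m+n\le 12$, $(y,m,d)+_m n\to(y,m+n,d)$; if $m+n<1$, $(y,m,d)+_m n\to(y-1,m,d)+_m(n+12)$; if $m+n>12$, $(y,m,d)+_m n\to(y+1,m,d)+_m(n-12)$. Days: write $N=\mathrm{nb\_days}(y,m)$. - If $d<1$ or $d>N$: $(y,m,d)+_d n\to\bot$. - If $1\le d\le N$ and $1\le d+n\le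 N$: $(y,m,d)+_d n\to(y,m,d+n)$. - If $1\le d\le N$ and $d+n>N$: $(y,m,d)+_d n\to((y,m,1)+_m 1)+_d(n-(N-d)-1)$. - If $1<d\le N$ and $d+n\le 0$: $(y,m,d)+_d n\to(y,m,1)+_d(d-1+n)$. - If $n+1\le 0$ and $(y,m,1)+_m(-1)\to^*(y',m',d')$ (a triple): $(y,m,1)+_d n\to(y',m',1)+_d(n+\mathrm{nb\_days}(y',m'))$. *)

(* Defs.v *)
From Stdlib Require Import ZArith Relation_Operators.

Open Scope Z_scope.

Inductive value : Type :=
| Bot : value
| Triple : forall y m d : Z, value.

Inductive dunit : Type := Year | Month | Day.

Inductive expr : Type :=
| Val : value -> expr
| Add : dunit -> expr -> Z -> expr.

Coercion Val : value >-> expr.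

Notation "e +_y n" := (Add Year e n) (at level 50, left associativity).
Notation "e +_m n" := (Add Month e n) (at level 50, left associativity).
Notation "e +_d n" := (Add Day e n) (at level 50, left associativity).

Definition is_leap (y : Z) : bool :=
  ((y mod 4 =? 0) && negb (y mod 100 =? 0)) || (y mod 400 =? 0).

(* Only meaningful for [1 <= m <= 12]; the value 0 on other [m] is a dummy. *)
Definition nb_days (y m : Z) : Z :=
  match m with
  | 1 | 3 | 5 | 7 | 8 | 10 | 12 => 31
  | 4 | 6 | 9 | 11 => 30
  | 2 => if is_leap y then 29 else 28
  | _ => 0
  end.

Reserved Notation "e --> e'" (at level 70, no associativity).
Reserved Notation "e -->* e'" (at level 70, no associativity).

(* The premise of [step_day_prev] uses the reflexive-transitive closure of the
   relation being defined.  The occurrence is strictly positive, so the nested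
   inductive is the least relation closed under the rules. *)
Inductive step : expr -> expr -> Prop :=
| step_bot : forall u n,
    Add u Bot n --> Bot
| step_bad_month : forall u y m d n,
    ~ (1 <= m <= 12) ->
    Add u (Triple y m d) n --> Bot
| step_congr : forall u e e' n,
    e --> e' ->
    Add u e n --> Add u e' n
| step_year : forall y m d n,
    1 <= m <= 12 ->
    Triple y m d +_y n --> Triple (y + n) m d
| step_month : forall y m d n,
    1 <= m <= 12 ->
    1 <= m + n <= 12 ->
    Triple y m d +_m n --> Triple y (m + n) d
| step_month_under : forall y m d n,
    1 <= m <= 12 ->
    m + n < 1 ->
    Triple y m d +_m n --> Triple (y - 1) m d +_m (n + 12)
| step_month_over : forall y m d n,
    1 <= m <= 12 ->
    m + n > 12 ->
    Triple y m d +_m n --> Triple (y + 1) m d +_m (n - 12)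
| step_bad_day : forall y m d n,
    1 <= m <= 12 ->
    d < 1 \/ d > nb_days y m ->
    Triple y m d +_d n --> Bot
| step_day : forall y m d n,
    1 <= m <= 12 ->
    1 <= d <= nb_days y m ->
    1 <= d + n <= nb_days y m ->
    Triple y m d +_d n --> Triple y m (d + n)
| step_day_over : forall y m d n,
    1 <= m <= 12 ->
    1 <= d <= nb_days y m ->
    d + n > nb_days y m ->
    Triple y m d +_d n --> Triple y m 1 +_m 1 +_d (n - (nb_days y m - d) - 1)
| step_day_under : forall y m d n,
    1 <= m <= 12 ->
    1 < d <= nb_days y m ->
    d + n <= 0 ->
    Triple y m d +_d n --> Triple y m 1 +_d (d - 1 + n)
| step_day_prev : forall y m n y' m' d',
    1 <= m <= 12 ->
    n + 1 <= 0 ->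
    Triple y m 1 +_m (-1) -->* Triple y' m' d' ->
    Triple y m 1 +_d n --> Triple y' m' 1 +_d (n + nb_days y' m')
where "e --> e'" := (step e e')
and "e -->* e'" := (clos_refl_trans expr step e e').

(* Main.v *)
(** Month additions terminate because [m + n] moves towards the interval
    [[1, 12]]. Once the date is valid, a nonnegative day offset strictly
    decreases at each crossing of a month end; a negative one, after resetting
    the day to 1, strictly increases at each month taken back until it is
    nonnegative. *)

Require Import Defs.
From Stdlib Require Import ZArith Relation_Operators Lia.

Open Scope Z_scope.

Lemma steps_head (e1 e2 e3 : expr) : e1 --> e2 -> e2 -->* e3 -> e1 -->* e3.
Proof. intros H12 H23. eapply rt_trans; [apply rt_step, H12 | exact H23]. Qed.

Lemma steps_congr (u : dunit) (e e' : expr) (n : Z) :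
  e -->* e' -> Add u e n -->* Add u e' n.
Proof.
  induction 1 as [e e' H | e | e1 e2 e3 _ IH12 _ IH23].
  - apply rt_step, step_congr, H.
  - apply rt_refl.
  - eapply rt_trans; eassumption.
Qed.

(** Makes the first of a month a valid day, and makes each month taken back strictly raise a
    negative day offset. *)
Lemma nb_days_pos (y m : Z) : 1 <= m <= 12 -> 1 <= nb_days y m.
Proof.
  intros Hm.
  assert (m = 1 \/ m = 2 \/ m = 3 \/ m = 4 \/ m = 5 \/ m = 6 \/ m = 7 \/
          m = 8 \/ m = 9 \/ m = 10 \/ m = 11 \/ m = 12) as Hcases by lia.
  repeat destruct Hcases as [-> | Hcases]; try subst m; simpl; try lia.
  destruct (is_leap y); lia.
Qed.

(* The measure is twice the distance from [m + n] to 13/2, the centre of [1, 12]: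
   unlike [Z.abs n], it decreases even for [m = 1], [n = -1]. *)
Lemma add_month_steps (y m d n : Z) :
  1 <= m <= 12 ->
  exists y' m', 1 <= m' <= 12 /\ Triple y m d +_m n -->* Triple y' m' d.
Proof.
  intros Hm.
  remember (Z.abs (2 * (m + n) - 13)) as k eqn:Hk.
  assert (0 <= k) as Hk0 by lia.
  revert y n Hk; pattern k; apply Zlt_0_ind; [clear k Hk0 | exact Hk0].
  intros k IH _ y n Hk.
  destruct (Z_lt_le_dec (m + n) 1) as [Hlow |].
  (* Here [2 * (m + n) - 13] is at most [-13], so adding 24 brings it strictly closer to 0. *)
  - destruct (IH (Z.abs (2 * (m + (n + 12)) - 13)) ltac:(lia)
                 (y - 1) (n + 12) eq_refl) as (y' & m' & Hm' & Hsteps).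
    exists y', m'; split; [exact Hm' |].
    eapply steps_head; [apply step_month_under; lia | exact Hsteps].
  - destruct (Z_lt_le_dec 12 (m + n)) as [Hhigh |].
    + destruct (IH (Z.abs (2 * (m + (n - 12)) - 13)) ltac:(lia)
                   (y + 1) (n - 12) eq_refl) as (y' & m' & Hm' & Hsteps).
      exists y', m'; split; [exact Hm' |].
      eapply steps_head; [apply step_month_over; lia | exact Hsteps].
    + exists y, (m + n); split; [lia |].
      apply rt_step, step_month; lia.
Qed.

Lemma add_day_nonneg_steps (y m d n : Z) :
  1 <= m <= 12 -> 1 <= d <= nb_days y m -> 0 <= n ->
  exists v : value, Triple y m d +_d n -->* v.
Proof.
  intros Hm Hd Hn; revert y m d Hm Hd.
  pattern n; apply Zlt_0_ind; [clear n Hn | exact Hn].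
  intros n IH Hn y m d Hm Hd.
  destruct (Z_le_gt_dec (d + n) (nb_days y m)).
  - exists (Triple y m (d + n)). apply rt_step, step_day; lia.
  - destruct (add_month_steps y m 1 1 Hm) as (y' & m' & Hm' & Hmonth).
    pose proof (nb_days_pos y' m' Hm').
    (* The new offset is nonnegative because [d + n] exceeds the month length, and below [n] because
       [d] does not. *)
    destruct (IH (n - (nb_days y m - d) - 1) ltac:(lia) y' m' 1 Hm' ltac:(lia))
      as (v & Hv).
    exists v.
    eapply steps_head; [apply step_day_over; lia |].
    eapply rt_trans; [apply steps_congr, Hmonth | exact Hv].
Qed.

(** The measure is [- n] cut off at 0: the last month taken back may overshoot to a positive offset,
    where the nonnegative case takes over. *)
Lemma add_day_first_steps (y m n : Z) :
  1 <= m <= 12 -> exists v : value, Triple y m 1 +_d n -->* v.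
Proof.
  intros Hm.
  remember (Z.max 0 (- n)) as k eqn:Hk.
  assert (0 <= k) as Hk0 by lia.
  revert y m n Hm Hk; pattern k; apply Zlt_0_ind; [clear k Hk0 | exact Hk0].
  intros k IH _ y m n Hm Hk.
  destruct (Z_lt_le_dec n 0) as [Hneg | Hnonneg].
  - destruct (add_month_steps y m 1 (-1) Hm) as (y' & m' & Hm' & Hmonth).
    pose proof (nb_days_pos y' m' Hm').
    destruct (IH (Z.max 0 (- (n + nb_days y' m'))) ltac:(lia)
                 y' m' (n + nb_days y' m') Hm' eq_refl) as (v & Hv).
    exists v.
    (* The month subtraction enters as the premise of [step_day_prev], not by congruence as in the
       forward case. *)
    eapply steps_head; [eapply step_day_prev; [lia | lia | exact Hmonth] | exact Hv].
  - pose proof (nb_days_pos y m Hm).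
    apply add_day_nonneg_steps; lia.
Qed.

Lemma add_day_steps (y m d n : Z) :
  1 <= m <= 12 -> exists v : value, Triple y m d +_d n -->* v.
Proof.
  intros Hm.
  destruct (Z_lt_le_dec d 1); [exists Bot; apply rt_step, step_bad_day; lia |].
  destruct (Z_lt_le_dec (nb_days y m) d);
    [exists Bot; apply rt_step, step_bad_day; lia |].
  destruct (Z_lt_le_dec n 0); [| apply add_day_nonneg_steps; lia].
  destruct (Z_lt_le_dec 0 (d + n)).
  - exists (Triple y m (d + n)). apply rt_step, step_day; lia.
  (* [step_day_under] demands [1 < d]: at day 1 it would loop, so a month is taken back at once. *)
  - destruct (Z.eq_dec d 1) as [-> | Hd1]; [apply add_day_first_steps, Hm |].
    destruct (add_day_first_steps y m (d - 1 + n) Hm) as (v & Hv).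
    exists v.
    eapply steps_head; [apply step_day_under; lia | exact Hv].
Qed.

Theorem theorem1 (D : value) (n : Z) (u : dunit) :
  exists v : value, Add u D n -->* v.
Proof.
  destruct D as [| y m d]; [exists Bot; apply rt_step, step_bot |].
  assert (1 <= m <= 12 \/ ~ 1 <= m <= 12) as [Hm | Hm] by lia;
    [| exists Bot; apply rt_step, step_bad_month, Hm].
  destruct u.
  - exists (Triple (y + n) m d). apply rt_step, step_year, Hm.
  - destruct (add_month_steps y m d n Hm) as (y' & m' & _ & Hsteps).
    exists (Triple y' m' d). exact Hsteps.
  - apply add_day_steps, Hm.
Qed.
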